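(* Let $p$ be an odd prime or $p=9$. Then $M(6p)\le 5$.
   Context: For a positive integer $n$, $\tau(n)$ denotes the number of positive divisors of $n$. For a positive integer $k$, $M(k)$ denotes the maximal length of a run of consecutive positive integers each having exactly $k$ divisors, i.e. the largest $L$ for which there is a positive integer $n$ with $\tau(n)=\tau(n+1)=\dots=\tau(n+L-1)=k$. *)

(* Defs.v *)
From mathcomp Require Import all_boot.
From mathcomp Require Import boolp.

Set Implicit Arguments.
Unset Strict Implicit.
Unset Printing Implicit Defensive.

Definition tau (n : nat) : nat := size (divisors n).

Definition has_run (k L : nat) : Prop :=
  exists2 n : nat, 0 < n & forall i : nat, i < L -> tau (n + i) = k.

Lemma has_run0 k : has_run k 0.
Proof. by exists 1. Qed.

(* Among 2 ^ k consecutive positive integers one is divisible by 2 ^ k, hence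
   has more than k divisors. *)
Lemma has_run_bound k L : has_run k L -> L <= 2 ^ k.
Proof.
case=> n n_gt0 run_n; rewrite leqNgt; apply/negP => ltL.
pose q := 2 ^ k; have q_gt0 : 0 < q by rewrite expn_gt0.
pose i := q - n %% q.
have le_iq : i <= q by rewrite leq_subr.
have tau_i := run_n i (leq_ltn_trans le_iq ltL).
have dvd_q : q %| n + i.
  rewrite {1}(divn_eq n q) -addnA /i subnKC; last by rewrite ltnW ?ltn_mod.
  by rewrite dvdn_addl // dvdn_mull.
have m_gt0 : 0 < n + i by rewrite addn_gt0 n_gt0.
suff : k < tau (n + i) by rewrite tau_i ltnn.
have uniq_pow : uniq [seq 2 ^ j | j <- iota 0 k.+1].
  by rewrite map_inj_uniq ?iota_uniq //; apply: expnI.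
have := uniq_leq_size uniq_pow (s2 := divisors (n + i)).
rewrite size_map size_iota; apply => _ /mapP[j j_in ->].
rewrite -dvdn_divisors //; apply: dvdn_trans dvd_q.
by apply: dvdn_exp2l; move: j_in; rewrite mem_iota add0n ltnS.
Qed.

(* The empty run L = 0 makes M total; for k > 0 it is never the maximum, since
   2 ^ k.-1 has exactly k divisors. *)
Lemma ex_run k : exists L, `[< has_run k L >].
Proof. by exists 0; apply/asboolP/has_run0. Qed.

Lemma run_bound k L : `[< has_run k L >] -> L <= 2 ^ k.
Proof. by move/asboolP/has_run_bound. Qed.

Definition M (k : nat) : nat := ex_maxn (ex_run k) (@run_bound k).

Lemma M_run k : has_run k (M k).
Proof. by rewrite /M; case: ex_maxnP => m /asboolP. Qed.

Lemma M_max k L : has_run k L -> L <= M k.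
Proof. by move=> runL; rewrite /M; case: ex_maxnP => m _; apply; apply/asboolP. Qed.

(* Main.v *)
Require Import Defs.
From mathcomp Require Import all_boot.
From mathcomp Require Import zify.

Set Implicit Arguments.
Unset Strict Implicit.
Unset Printing Implicit Defensive.

(** Suppose that six consecutive integers all have [6 * p] divisors, [p] odd.
    If [q * m] is one of them, with [q] prime and coprime to [m], then
    [tau m = 3 * p] is odd, so [m] is a square.  With [q = 2], every member that
    is 2 modulo 4 is [2 * s ^ 2] with [s] odd, hence 2 modulo 16; two such
    members cannot differ by 4, so there is only one.  The run then contains
    [2 * s ^ 2 - 2] and one of [2 * s ^ 2 + 3] and [2 * s ^ 2 - 3].  If 3 divides
    [s], the latter is three times a square, again with [q = 3], which is
    impossible modulo 8.

    So 3 does not divide [s].  Write [s = 2 * y + 1], so that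
    [2 * s ^ 2 - 2 = 8 * y * (y + 1)], and
    [y * (y + 1) = 2 ^ g * 3 ^ f * r] with [r] coprime to 6, [g, f > 0] and
    [(g + 4) * (f + 1) * tau r = 6 * p].  When [p] is prime or 9 this leaves so
    few triples that in each of them a single prime power, [2 ^ g], [3 ^ f] or
    [r], can be discarded to leave a small cofactor.  As a prime power divides
    only one of the coprime numbers [y] and [y + 1], the other one, [z], divides
    this cofactor (lemma [small_consecutive_factor]): [z] divides
    [9 * 2 ^ (p - 4)] or 4.

    On the other hand [tau (s ^ 2) = 3 * p].  For [p] prime this forces
    [s >= 5 ^ ((p + 1) / 2)] (lemma [expn5_le_sqrt]), far above
    [2 * z + 1 >= s].  For [p = 9] the number [s] is [2 * z + 1] or [2 * z - 1]
    with [z] a divisor of 288, and none of these squares has 27 divisors. *)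

(** * The number of divisors *)

(** [divisors] treats the prime powers [q ^ e] of [n] one at a time, merging
    [e + 1] scaled copies of the current list, so each multiplies the length by
    [e + 1]. *)
Lemma tauE n : tau n = \prod_(q <- primes n) (logn q n).+1.
Proof.
rewrite -(big_map (fun q => (q, logn q n)) xpredT (fun f => f.2.+1)).
rewrite -prime_decompE /tau /divisors.
elim: (prime_decomp n) => [|[q e] s IHs]; first by rewrite big_nil.
rewrite big_cons -IHs /=; move: (foldr _ _ _) => d.
elim: e => [|e IHe]; first by rewrite mul1n.
by rewrite /= size_merge size_cat size_map IHe mulSn addnC -mulSn.
Qed.

Lemma tau_gt0 n : 0 < tau n.
Proof. by rewrite tauE prodn_gt0. Qed.

Lemma tau_coprimeM m n :
  0 < m -> 0 < n -> coprime m n -> tau (m * n) = tau m * tau n.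
Proof.
move=> m_gt0 n_gt0 co_mn; rewrite !tauE.
have perm_mn : perm_eq (primes (m * n)) (primes m ++ primes n).
  apply: uniq_perm; rewrite ?cat_uniq ?primes_uniq //= ?andbT.
    by rewrite -coprime_has_primes // coprime_sym.
  by move=> q; rewrite primesM // mem_cat.
rewrite (perm_big _ perm_mn) big_cat /=; congr (_ * _);
  apply: eq_big_seq => q; rewrite mem_primes => /and3P[_ _ dvd_q].
- rewrite lognM // (@logn_coprime q n) ?addn0 //.
  exact: coprime_dvdl dvd_q co_mn.
- rewrite lognM // (@logn_coprime q m) //.
  by rewrite coprime_sym; apply: coprime_dvdr dvd_q co_mn.
Qed.

Lemma tau_pfactor q a : prime q -> tau (q ^ a) = a.+1.
Proof.
move=> q_pr; case: a => [|a]; first by rewrite tauE big_nil.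
by rewrite tauE primesX // primes_prime // big_seq1 lognX logn_prime // eqxx muln1.
Qed.

Lemma tau_pfactorM q a m :
  prime q -> 0 < m -> coprime q m -> tau (q ^ a * m) = a.+1 * tau m.
Proof.
move=> q_pr m_gt0 co_qm.
by rewrite tau_coprimeM ?tau_pfactor ?coprimeXl // expn_gt0 prime_gt0.
Qed.

Lemma tau_sqr n : tau (n ^ 2) = \prod_(q <- primes n) (2 * logn q n).+1.
Proof. by rewrite tauE primesX //; apply: eq_bigr => q _; rewrite lognX. Qed.

(** This form evaluates from the factorization of [n] alone, without writing
    [n ^ 2] in unary. *)
Lemma tau_sqr_foldr n :
  tau (n ^ 2) = foldr (fun f t => (2 * f.2).+1 * t) 1 (prime_decomp n).
Proof. by rewrite tau_sqr prime_decompE foldr_map unlock /reducebig. Qed.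

Lemma tau_sqrM q a m : prime q -> 0 < m -> coprime q m ->
  tau ((m * q ^ a) ^ 2) = (2 * a).+1 * tau (m ^ 2).
Proof.
move=> q_pr m_gt0 co_qm; rewrite expnMn -expnM mulnC [a * 2]mulnC.
by rewrite tau_pfactorM ?coprimeXr ?expn_gt0 ?m_gt0.
Qed.

(** If the product of the [e + 1] is odd then so is each factor, so all the
    exponents [e] are even. *)
Lemma odd_tau_sqr n : 0 < n -> odd (tau n) -> exists s, n = s ^ 2.
Proof.
move=> n_gt0; rewrite tauE => odd_tau.
exists (\prod_(q <- primes n) q ^ (logn q n)./2).
rewrite {1}[n]prod_prime_decomp // prime_decompE big_map /=.
rewrite -[RHS]mulnn -big_split /=; apply: eq_big_seq => q q_n.
rewrite -expnD addnn even_halfK //.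
by move: odd_tau; rewrite (big_rem q) //= oddM /= => /andP[].
Qed.

(** Two distinct prime divisors would already give [2 * 2] divisors. *)
Lemma tau_le3_primepower r : 0 < r -> tau r <= 3 ->
  exists q c, prime q /\ r = q ^ c.
Proof.
have split_gt1 m : 1 < m -> exists q a u,
    [/\ prime q, 0 < u, m = u * q ^ a.+1 & tau m = a.+2 * tau u].
  move=> m_gt1; have q_pr := pdiv_prime m_gt1.
  have m_gt0 := ltnW m_gt1.
  have [u co_qu def_m] := pfactor_coprime q_pr m_gt0.
  have u_gt0 : 0 < u by case: u def_m {co_qu} => //; lia.
  have a_gt0 : 0 < logn (pdiv m) m.
    by rewrite logn_gt0 mem_primes q_pr m_gt0 pdiv_dvd.
  exists (pdiv m), (logn (pdiv m) m).-1, u; rewrite prednK //; split => //.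
  by rewrite {1}def_m mulnC tau_pfactorM.
move=> r_gt0 tau_r; have [r_gt1|r_le1] := ltnP 1 r; last first.
  by exists 2, 0; split=> //; lia.
have [q [a [u [q_pr u_gt0 def_r tau_rE]]]] := split_gt1 _ r_gt1.
exists q, a.+1; split=> //; suff u1 : u = 1 by rewrite def_r u1 mul1n.
have [u_gt1|] := ltnP 1 u; last lia.
have [_ [b [v [_ _ _ tau_u]]]] := split_gt1 _ u_gt1.
have := tau_gt0 v; nia.
Qed.

(** * Size of the square root *)

(** The prime [p] divides [2 * a + 1] for some exponent [a] of [s].  If
    [2 * a + 1 = p], then [s] has another prime factor to account for the
    remaining 3 in [tau (s ^ 2)]; otherwise [2 * a + 1 >= 2 * p].  Either way [s]
    has at least [(p + 1) / 2] prime factors with multiplicity, each at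
    least 5. *)
Lemma expn5_le_sqrt p s : prime p -> odd p -> 0 < s -> ~~ (2 %| s) -> ~~ (3 %| s) ->
  tau (s ^ 2) = 3 * p -> 5 ^ (p./2).+1 <= s.
Proof.
move=> p_pr odd_p s_gt0 s2 s3 tau_s.
have ge5 q : prime q -> q %| s -> 5 <= q.
  case: q => [|[|[|[|[|q]]]]] // _; [by rewrite (negPf s2)|by rewrite (negPf s3)].
have p_dvd : p %| tau (s ^ 2) by rewrite tau_s dvdn_mull.
have [q q_s p_q] : exists2 q, q \in primes s & p %| (2 * logn q s).+1.
  apply/hasP; move: p_dvd; rewrite tau_sqr Euclid_dvd_prod // => dvd_p.
  by rewrite -big_has.
have := q_s; rewrite mem_primes => /and3P[q_pr _ /(ge5 _ q_pr) q_ge5].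
have [u co_qu def_s] := pfactor_coprime q_pr s_gt0.
set a := logn q s in p_q def_s.
have u_gt0 : 0 < u by case: u def_s {co_qu} => //; lia.
have tau_u : (2 * a).+1 * tau (u ^ 2) = 3 * p by rewrite -(tau_sqrM _ q_pr u_gt0 co_qu) -def_s.
have qa : 5 ^ a <= q ^ a by case: (a) => // n; rewrite leq_exp2r.
have [j def_j] := dvdnP p_q.
have [u_gt1|u_le1] := ltnP 1 u; last first.
  have u1 : u = 1 by lia.
  move: tau_u; rewrite u1 tau_sqr big_nil muln1 => tau_u.
  apply: leq_trans (_ : 5 ^ a <= _); last by rewrite def_s u1 mul1n.
  rewrite leq_exp2l //; have := prime_gt1 p_pr; lia.
have u_ge5 : 5 <= u.
  apply: leq_trans (ge5 _ (pdiv_prime u_gt1) _) (pdiv_leq u_gt0).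
  by rewrite def_s dvdn_mulr ?pdiv_dvd.
rewrite def_s expnS leq_mul //; apply: leq_trans qa.
rewrite leq_exp2l //.
have : p <= (2 * a).+1 by apply: dvdn_leq.
lia.
Qed.

(** * Factorization of a product of two consecutive integers *)

(** The prime [q] misses [y] or [y + 1]; the one it misses is coprime to
    [q ^ c]. *)
Lemma primepower_dvd_consecutive A q c y :
  prime q -> y * y.+1 = A * q ^ c ->
  exists2 z, z = y \/ z = y.+1 & z %| A.
Proof.
move=> q_pr def_y.
have [q_y|q_y] := boolP (q %| y).
  have co : coprime y.+1 (q ^ c).
    rewrite coprimeXr // coprime_sym prime_coprime // -addn1 dvdn_addr //.
    by rewrite Euclid_dvd1.
  exists y.+1; [by right | rewrite -(Gauss_dvdl _ co) -def_y; exact: dvdn_mull].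
have co : coprime y (q ^ c) by rewrite coprimeXr // coprime_sym prime_coprime.
by exists y; [left | rewrite -(Gauss_dvdl _ co) -def_y; exact: dvdn_mulr].
Qed.

(** Here [D], [F] and [T] are the contributions to [6 * p] of the powers of 2
    and 3 and of the remaining cofactor.  The alternatives are grouped by what
    they are used for: the prime power to discard is that of 2 when [T = 1] and
    [F <= 3], that of 3 in the other cases with [T = 1], and the cofactor
    otherwise. *)
Lemma tau_exponent_cases p D F T : (prime p /\ odd p) \/ p = 9 ->
  D * F * T = 6 * p -> 5 <= D -> 2 <= F ->
  T = 1 /\ (F <= 3 \/ D <= p \/ D = 6) \/ T <= 3 /\ F <= 3 /\ D <= p.
Proof.
move=> hp DFT D5 F2.
have T0 : 0 < T by case: T DFT => //; case: hp => [[/prime_gt0]|]; lia.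
case: hp => [[p_pr odd_p]|p9]; last first.
  have F6 : F * T <= 10 by nia.
  have F10 : F <= 10 by nia.
  have T5 : T <= 5 by nia.
  rewrite {}p9 in DFT *.
  by move: F T F2 F10 T0 T5 DFT {F6} => [|[|[|[|[|[|[|[|[|[|[]]]]]]]]]]] //
    [|[|[|[|[|[]]]]]] // *; lia.
have p3 : 3 <= p by have := prime_gt1 p_pr; lia.
have cancel_p k : p * k = 6 * p -> k = 6.
  by rewrite mulnC => /eqP; rewrite eqn_pmul2r ?prime_gt0 // => /eqP.
have D_eq6 : D %| 6 -> D = 6.
  move=> D_6; have : D <= 6 by apply: dvdn_leq D_6.
  by case: D D5 D_6 {DFT} => [|[|[|[|[|[|[|]]]]]]].
have : p %| D * F * T by rewrite DFT dvdn_mull.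
rewrite !Euclid_dvdM // -orbA => /or3P[] /dvdnP[j def_j].
- have jFT : j * F * T = 6 by apply: cancel_p; rewrite -DFT def_j; lia.
  have T6 : T %| 6 by rewrite -jFT dvdn_mull.
  have F6 : F %| 6 by rewrite -jFT dvdn_mulr ?dvdn_mull.
  have {}T6 : T <= 6 by apply: dvdn_leq T6.
  have {}F6 : F <= 6 by apply: dvdn_leq F6.
  by move: F T F2 T0 F6 T6 jFT {DFT} => [|[|[|[|[|[|[|?]]]]]]] //
     [|[|[|[|[|[|[|?]]]]]]] // *; nia.
- have jDT : j * D * T = 6 by apply: cancel_p; rewrite -DFT def_j; lia.
  have D6 : D = 6 by apply: D_eq6; rewrite -jDT dvdn_mulr ?dvdn_mull.
  have : j * T == 1 by rewrite D6 in jDT; lia.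
  by rewrite muln_eq1 => /andP[_ /eqP T1]; left; split; [|right; right].
- have jDF : j * D * F = 6 by apply: cancel_p; rewrite -DFT def_j; lia.
  have D6 : D = 6 by apply: D_eq6; rewrite -jDF dvdn_mulr ?dvdn_mull.
  have : j * F == 1 by rewrite D6 in jDF; lia.
  by rewrite muln_eq1 => /andP[_ /eqP F1]; rewrite F1 in F2.
Qed.

(** The two bounds on [z] come from discarding one prime power from
    [y * (y + 1) = 2 ^ g * 3 ^ f * r].  What is left divides
    [9 * 2 ^ (p - 4)], except when [3 ^ f] is discarded with [g = 2], which
    leaves 4.  For [p = 3] the truncated exponent gives the bound 9, which is
    the correct one. *)
Lemma small_consecutive_factor p y : (prime p /\ odd p) \/ p = 9 ->
  0 < y -> 3 %| y * y.+1 -> tau (8 * (y * y.+1)) = 6 * p ->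
  exists2 z, z = y \/ z = y.+1 & z %| 9 * 2 ^ (p - 4) \/ z %| 4.
Proof.
move=> hp y_gt0 y3 tau_y.
have w_gt0 : 0 < y * y.+1 by rewrite muln_gt0 y_gt0.
have [v co_2v def_v] := pfactor_coprime (isT : prime 2) w_gt0.
have v_gt0 : 0 < v by case: v def_v {co_2v} => //; lia.
have [r co_3r def_r] := pfactor_coprime (isT : prime 3) v_gt0.
have r_gt0 : 0 < r by case: r def_r {co_3r} => //; lia.
set g := logn 2 _ in def_v; set f := logn 3 _ in def_r.
have g_gt0 : 0 < g.
  by rewrite logn_gt0 mem_primes w_gt0 dvdn2 oddM /=; case: odd.
have f_gt0 : 0 < f.
  rewrite logn_gt0 mem_primes v_gt0 /=.
  by move: y3; rewrite def_v Gauss_dvdl // coprimeXr.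
have def_w : y * y.+1 = 2 ^ g * 3 ^ f * r by rewrite def_v {1}def_r; lia.
have tau_w : (g + 4) * f.+1 * tau r = 6 * p.
  have -> : g + 4 = (g + 3).+1 by rewrite addnS.
  have def_8w : 8 * (y * y.+1) = 2 ^ (g + 3) * v by rewrite def_v expnD; lia.
  rewrite -tau_y def_8w tau_pfactorM // def_r [r * _]mulnC tau_pfactorM //.
  by rewrite mulnA.
have D5 : 5 <= g + 4 by lia.
have F2 : 2 <= f.+1 by [].
have f9 : f.+1 <= 3 -> 3 ^ f %| 9 by move=> f3; rewrite (@dvdn_exp2l 3 f 2).
have g_p : g + 4 <= p -> 2 ^ g %| 2 ^ (p - 4) by move=> gp; apply: dvdn_exp2l; lia.
(* Two or three divisors: r itself is a prime power and can be discarded. *)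
have [[T1 cases]|[T3 [F3 Dp]]] := tau_exponent_cases hp tau_w D5 F2; last first.
  have [q [c [q_pr def_q]]] := tau_le3_primepower r_gt0 T3.
  rewrite def_q in def_w.
  have [z yz z_dvd] := primepower_dvd_consecutive q_pr def_w.
  exists z => //; left; apply: dvdn_trans z_dvd _.
  by rewrite mulnC dvdn_mul ?f9 ?g_p.
have r1 : r = 1.
  have T3 : tau r <= 3 by rewrite T1.
  have [q [c [q_pr def_q]]] := tau_le3_primepower r_gt0 T3.
  by move: T1; rewrite def_q tau_pfactor // => -[->].
rewrite {}r1 muln1 in def_w.
have Q3 : g + 4 <= p \/ g = 2 ->
    exists2 z, z = y \/ z = y.+1 & z %| 9 * 2 ^ (p - 4) \/ z %| 4.
  have [z yz z_dvd] := primepower_dvd_consecutive (isT : prime 3) def_w.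
  case=> [gp|g2]; exists z => //.
    by left; apply: dvdn_mull; apply: dvdn_trans z_dvd (g_p gp).
  by right; rewrite g2 in z_dvd.
case: cases => [F3|[Dp|D6]]; [|by apply: Q3; left|by apply: Q3; right; lia].
rewrite [RHS]mulnC in def_w.
have [z yz z_dvd] := primepower_dvd_consecutive (isT : prime 2) def_w.
by exists z => //; left; apply: dvdn_mulr; apply: dvdn_trans z_dvd (f9 F3).
Qed.

(** The induction starts at [p = 5]; [p = 3], where [2 ^ (p - 4)] is 1 by
    truncation, is the inequality [19 < 25]. *)
Lemma ltn_expn5 p : odd p -> 3 <= p -> 18 * 2 ^ (p - 4) + 1 < 5 ^ (p./2).+1.
Proof.
move=> odd_p p3.
have grow k : 36 * 4 ^ k + 1 < 5 ^ k.+3.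
  elim: k => // k; rewrite [4 ^ k.+1]expnS [5 ^ k.+4]expnS.
  by move: (4 ^ k) (5 ^ _) => a b; lia.
have [->//|p_neq3] := eqVneq p 3.
have [k ->] : exists k, p = 2 * k + 5 by exists ((p - 5) %/ 2); lia.
have -> : ((2 * k + 5)./2).+1 = k.+3 by lia.
have -> : 2 * k + 5 - 4 = (2 * k).+1 by lia.
by rewrite [2 ^ _.+1]expnS expnM mulnA.
Qed.

Lemma tau_sqr_neq27 z : z %| 288 ->
  (tau ((2 * z).-1 ^ 2) != 27) && (tau ((2 * z).+1 ^ 2) != 27).
Proof.
rewrite dvdn_divisors // => z_288.
have := allP (_ : all (fun x => (tau (x.*2.-1 ^ 2) != 27)
                             && (tau (x.*2.+1 ^ 2) != 27)) (divisors 288)) z z_288.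
rewrite mul2n; apply.
under eq_all => x do rewrite !tau_sqr_foldr.
by vm_compute.
Qed.

(** The small factor [z] of [y * (y + 1)] bounds [s = 2 * y + 1] by
    [2 * z + 1], too small for [tau (s ^ 2) = 3 * p]. *)
Lemma tau_consecutive_neq p y : (prime p /\ odd p) \/ p = 9 ->
  0 < y -> ~~ (3 %| (2 * y).+1) ->
  tau ((2 * y).+1 ^ 2) = 3 * p -> tau (8 * (y * y.+1)) != 6 * p.
Proof.
move=> hp y_gt0 s3 tau_s; apply/eqP => tau_y.
have y3 : 3 %| y * y.+1 by rewrite Euclid_dvdM //; lia.
have [z yz z_dvd] := small_consecutive_factor hp y_gt0 y3 tau_y.
case: hp => [[p_pr odd_p]|p9].
  have s2 : ~~ (2 %| (2 * y).+1) by lia.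
  have p3 : 3 <= p by have := prime_gt1 p_pr; lia.
  have s_ge := expn5_le_sqrt p_pr odd_p (ltn0Sn _) s2 s3 tau_s.
  have grow := ltn_expn5 odd_p p3.
  have pow_gt0 : 0 < 2 ^ (p - 4) by rewrite expn_gt0.
  have le_z : z <= 9 * 2 ^ (p - 4).
    case: z_dvd => /dvdn_leq z_le; last by have := z_le isT; lia.
    by apply: z_le; rewrite muln_gt0.
  by move: (5 ^ _) (2 ^ _) s_ge le_z grow {pow_gt0 z_dvd} => a b *; lia.
rewrite {}p9 in z_dvd tau_s.
have z_288 : z %| 288 by case: z_dvd => // z4; apply: dvdn_trans z4 _.
have /andP[] := tau_sqr_neq27 z_288.
case: yz => -> /eqP no_pred /eqP no_succ; first exact: no_succ.
by apply: no_pred; rewrite mulnS.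
Qed.

(** * Runs of six *)

Lemma tau_6p_sqr p q m : odd p -> prime q -> 0 < m -> coprime q m ->
  tau (q * m) = 6 * p -> exists2 s, m = s ^ 2 & tau (s ^ 2) = 3 * p.
Proof.
move=> odd_p q_pr m_gt0 co_qm tau_qm.
have tau_m : tau m = 3 * p.
  by move: tau_qm; rewrite -[q in q * m]expn1 tau_pfactorM //; lia.
have [|s def_m] := odd_tau_sqr m_gt0; first by rewrite tau_m oddM odd_p.
by exists s; rewrite -?def_m.
Qed.

(** The odd square is given as that of [2 * y + 1] so that the member of the run
    two places below appears as [8 * y * (y + 1)]. *)
Lemma twice_odd_sqr p m : odd p -> m %% 4 = 2 -> tau m = 6 * p ->
  exists2 y, m = 8 * (y * y.+1) + 2 & tau ((2 * y).+1 ^ 2) = 3 * p.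
Proof.
move=> odd_p m4 tau_m; have def_m : m = 2 * m./2 by lia.
rewrite def_m in tau_m.
have [||s def_s tau_s] := tau_6p_sqr odd_p (isT : prime 2) _ _ tau_m.
- lia.
- by rewrite coprime2n; lia.
have odd_s : odd s by have : odd m./2 by [lia]; rewrite def_s oddX.
have def_y : s = (2 * s./2).+1 by lia.
by exists s./2; rewrite -?def_y // def_m def_s {1}def_y; lia.
Qed.

Lemma odd_sqr_mod8 x : odd x -> x ^ 2 %% 8 = 1.
Proof.
move=> odd_x; rewrite -modnXm.
have : x %% 8 < 8 by rewrite ltn_mod.
have : odd (x %% 8) by lia.
by case: (x %% 8) => [|[|[|[|[|[|[|[|]]]]]]]].
Qed.

(** Otherwise [m] would be an odd square, hence 1 modulo 8, whereas
    [6 * u ^ 2] is 6 modulo 8. *)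
Lemma tau_triple_six_sqr p u m : odd p -> odd u -> m = 6 * u ^ 2 + 1 \/ m.+1 = 6 * u ^ 2 ->
  tau (3 * m) != 6 * p.
Proof.
move=> odd_p odd_u def_m; apply/eqP => tau_m.
have [||t def_t _] := tau_6p_sqr odd_p (isT : prime 3) _ _ tau_m.
- nia.
- by rewrite prime_coprime //; lia.
have odd_t : odd t by have : odd (t ^ 2) by [lia]; rewrite oddX.
have := odd_sqr_mod8 odd_t; have := odd_sqr_mod8 odd_u; lia.
Qed.

Lemma no_run6 p n : (prime p /\ odd p) \/ p = 9 -> 0 < n ->
  ~ (forall i, i < 6 -> tau (n + i) = 6 * p).
Proof.
move=> hp n_gt0 run_n.
have odd_p : odd p by case: hp => [[]|->].
have twice i : i < 6 -> (n + i) %% 4 = 2 ->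
    exists2 y, n + i = 8 * (y * y.+1) + 2 & tau ((2 * y).+1 ^ 2) = 3 * p.
  by move=> i6 ni; apply: twice_odd_sqr; rewrite ?run_n.
(* y (y + 1) is even, so 8 y (y + 1) + 2 is 2 modulo 16: two numbers of this
   form cannot differ by 4. *)
have no_pair i j : i < 6 -> j = i + 4 -> j < 6 -> (n + i) %% 4 <> 2.
  move=> i6 def_j j6 ni; have nj : (n + j) %% 4 = 2 by lia.
  have [y def_y _] := twice i i6 ni; have [x def_x _] := twice j j6 nj.
  have even_y : ~~ odd (y * y.+1) by rewrite oddM /= andbN.
  have even_x : ~~ odd (x * x.+1) by rewrite oddM /= andbN.
  lia.
(* The members i and j are those at distance 2 and 3 from 2 s ^ 2, where
   s = 2 y + 1. *)
have finish y i j : i < 6 -> j < 6 -> 0 < n + i -> n + i = 8 * (y * y.+1) ->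
   n + j = 8 * (y * y.+1) + 5 \/ n + j + 1 = 8 * (y * y.+1) ->
   tau ((2 * y).+1 ^ 2) <> 3 * p.
  move=> i6 j6 ni_gt0 def_i def_j tau_s.
  have y_gt0 : 0 < y by case: y def_i {def_j tau_s} => //; lia.
  have [s3|s3] := boolP (3 %| (2 * y).+1).
    have [u def_u] := dvdnP s3.
    have odd_u : odd u by lia.
    have tau_j := run_n j j6.
    have [m def_m] : exists m, n + j = 3 * m.
      by exists ((n + j) %/ 3); have : 8 * (y * y.+1) + 2 = 2 * (3 * u) ^ 2; nia.
    have : m = 6 * u ^ 2 + 1 \/ m.+1 = 6 * u ^ 2 by nia.
    by move/(tau_triple_six_sqr odd_p odd_u)/eqP; rewrite -def_m.
  by have /eqP := tau_consecutive_neq hp y_gt0 s3 tau_s; rewrite -def_i run_n.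
(* When n is 1 or 2 modulo 4, the run has two members that are 2 modulo 4. *)
have [n0|[n1|[n2|n3]]] : n %% 4 = 0 \/ n %% 4 = 1 \/ n %% 4 = 2 \/ n %% 4 = 3 by lia.
- have [|y def_y tau_s] := twice 2 isT; first lia.
  by apply: (finish y 0 5) tau_s => //; lia.
- by apply: (no_pair 1 5) => //; lia.
- by apply: (no_pair 0 4) => //; lia.
- have [|y def_y tau_s] := twice 3 isT; first lia.
  by apply: (finish y 1 0) tau_s => //; lia.
Qed.

Theorem theorem1 (p : nat) (hp : (prime p /\ odd p) \/ p = 9) : M (6 * p) <= 5.
Proof.
rewrite leqNgt; apply/negP => M_gt5.
have [n n_gt0 run_n] := M_run (6 * p).
by apply: (no_run6 hp n_gt0) => i i6; apply: run_n; apply: leq_trans M_gt5.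
Qed.
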